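(* Let $F$ be a free filter on $\omega$. The following are equivalent: (a) $F$ has the Nikodym property; (b) there is no sequence $\langle\mu_n\colon n\in\omega\rangle$ of finitely supported non-negative measures on $N_F$ such that (1) $\mathrm{supp}(\mu_n)\subseteq\omega$ for every $n\in\omega$, (2) $\lim_{n\to\infty}\mu_n(\omega)=\infty$, and (3) $\lim_{n\to\infty}\mu_n(\omega\setminus A)=0$ for every $A\in F$; (c) there is no sequence as in (b) whose measures moreover have pairwise disjoint supports.
   Context: A filter $F$ on $\omega$ is free if it contains all cofinite subsets of $\omega$. For a free filter $F$, $N_F=\omega\cup\{p_F\}$ (with $p_F\notin\omega$) carries the topology in which every $n\in\omega$ is isolated and the open neighbourhoods of $p_F$ are exactly the sets $A\cup\{p_F\}$ with $A\in F$. A finitely supported measure on $N_F$ is $\mu=\sum_{i=1}^k\alpha_i\delta_{x_i}$ with distinct $x_i\in N_F$ and nonzero reals $\alpha_i$; $\mathrm{supp}(\mu)=\{x_1,\dots,x_k\}$, $\|\mu\|=\sum_i|\alpha_i|$. A sequence $\langle\mu_n\rangle$ of finitely supported measures on $N_F$ is an anti-Nikodym (AN) sequence if $\|\mu_n\|\to\infty$ and $\mu_n(A)\to0$ for every clopen $A\subseteq N_F$. $F$ has the Nikodym property if there is no AN-sequence on $N_F$. *)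

(* Defs.v *)
From HB Require Import structures.
From mathcomp Require Import all_boot all_order all_algebra finmap.
From mathcomp Require Import all_classical all_reals topology normedtype.
From mathcomp Require Import numfun.

Set Implicit Arguments.
Unset Strict Implicit.
Unset Printing Implicit Defensive.

Import Order.TTheory GRing.Theory Num.Theory.
Import numFieldNormedType.Exports.

Local Open Scope classical_set_scope.
Local Open Scope ring_scope.

(* Filters are proper throughout ([pfilter_on]). *)
Definition free_filter (F : pfilter_on nat) : Prop :=
  forall A : set nat, finite_set (~` A) -> F A.

(* N_F: the point [Some n] stands for n, and [None] for p_F. *)
Definition filter_space (F : pfilter_on nat) : Type := option nat.

Section FilterSpaceTopology.
Variable F : pfilter_on nat.

HB.instance Definition _ := Choice.copy (filter_space F) (option nat).

Definition pt (n : nat) : filter_space F := Some n.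
Definition pF : filter_space F := None.
Definition omega : set (filter_space F) := range pt.

(* Open sets: any set missing p_F is open, and a set containing p_F is open
   iff its trace on omega belongs to F. *)
Definition fs_open : set_system (filter_space F) :=
  [set U | U pF -> F (pt @^-1` U)].

Let fs_openT : fs_open setT.
Proof. by move=> _; exact: filterT. Qed.

Let fs_openI : setI_closed fs_open.
Proof. by move=> A B oA oB [Ap Bp]; apply: filterI; [exact: oA|exact: oB]. Qed.

Let fs_open_bigU (I : Type) (f : I -> set (filter_space F)) :
  (forall i, fs_open (f i)) -> fs_open (\bigcup_i f i).
Proof.
by move=> of_ [i _ fip]; apply: filterS (of_ i fip) => n fin; exists i.
Qed.

HB.instance Definition _ := isOpenTopological.Build (filter_space F)
  fs_openT fs_openI fs_open_bigU.

Lemma open_fsE (U : set (filter_space F)) :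
  open U <-> (U pF -> F (pt @^-1` U)).
Proof.
rewrite openE; split=> [oU Up|oU x Ux]; last by exists U; split.
by have [B [oB Bp BU]] := oU _ Up; apply: filterS (oB Bp) => n; exact: BU.
Qed.

Lemma open_pt (n : nat) : open [set pt n].
Proof. by apply/open_fsE. Qed.

Lemma open_nbhs_pFE (U : set (filter_space F)) :
  open_nbhs pF U <-> exists2 A, F A & U = pF |` (pt @` A).
Proof.
split=> [[/open_fsE oU Up]|[A FA ->]].
  exists (pt @^-1` U); first exact: oU.
  apply/seteqP; split=> [[n|] Ux|_ [->//|[n Un <-]//]]; last by left.
  by right; exists n.
split; last by left.
by apply/open_fsE => _; apply: filterS FA => n An; right; exists n.
Qed.

End FilterSpaceTopology.

Arguments pt : clear implicits.
Arguments omega : clear implicits.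

Section FinitelySupportedMeasures.
Variables (R : realType) (F : pfilter_on nat).

(* The measure sum_i alpha_i delta_{x_i}, with distinct x_i and nonzero
   alpha_i, is encoded by its coefficient function, sending x_i to alpha_i and
   every other point to 0; its support {x_1, ..., x_k} is then [finsupp mu]. *)
Definition fs_measure := {fsfun filter_space F -> R with 0}.

Implicit Types mu : fs_measure.

Definition supp mu : set (filter_space F) := [set` finsupp mu].

(* \1_A x is the value delta_x(A). *)
Definition fs_eval mu (A : set (filter_space F)) : R :=
  \sum_(x <- finsupp mu) mu x * \1_A x.

Definition fs_norm mu : R := \sum_(x <- finsupp mu) `|mu x|.

Definition fs_nonneg mu : Prop := forall A, 0 <= fs_eval mu A.

Definition anti_Nikodym (mu : nat -> fs_measure) : Prop :=
  fs_norm (mu n) @[n --> \oo] --> +oo /\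
  forall A : set (filter_space F), clopen A ->
    fs_eval (mu n) A @[n --> \oo] --> (0 : R).

Definition Nikodym : Prop := ~ exists mu : nat -> fs_measure, anti_Nikodym mu.

Definition dual_vanishing (mu : nat -> fs_measure) : Prop :=
  [/\ forall n, fs_nonneg (mu n),
      forall n, supp (mu n) `<=` omega F,
      fs_eval (mu n) (omega F) @[n --> \oo] --> +oo &
      forall A : set nat, F A ->
        fs_eval (mu n) (omega F `\` (pt F @` A)) @[n --> \oo] --> (0 : R)].

End FinitelySupportedMeasures.

Arguments Nikodym : clear implicits.

(* Main.v *)
Require Import Defs.
From HB Require Import structures.
From mathcomp Require Import all_boot all_order all_algebra finmap.
From mathcomp Require Import all_classical all_reals topology normedtype.
From mathcomp Require Import numfun.
From mathcomp Require Import zify lra.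

Set Implicit Arguments.
Unset Strict Implicit.

Import Order.TTheory GRing.Theory Num.Theory.
Import numFieldNormedType.Exports.

Local Open Scope classical_set_scope.
Local Open Scope ring_scope.

(** A non-negative sequence mu_n as in (b) becomes an anti-Nikodym sequence once
    the mass mu_n(omega) is subtracted at p_F. Conversely, let mu_n be
    anti-Nikodym. If A is in F, every subset of omega \ A is clopen in N_F, so
    by the Schur property of l^1 (a gliding hump argument) |mu_n|(omega \ A)
    tends to 0. As mu_n(N_F) tends to 0, the mass at p_F is asymptotically at
    most |mu_n|(omega), hence |mu_n|(omega) tends to infinity. Finally
    |mu_n|([0, m)) tends to 0 for each m because F is free, so a subsequence of
    |mu_n| can be cut down to disjoint intervals without losing its mass. *)

(** * The Schur property of l^1 by a gliding hump *)

(** Split by sign: the positive and the negative part of [w] together make up the left-hand side, so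
    the larger of the two carries at least half of it. [P] is the set where [w] has the
    corresponding sign. *)
Lemma half_sum_norm_le (R : realType) (w : nat -> R) (a b : nat) :
  exists P : set nat,
    \sum_(a <= i < b) `|w i| <= 2 * `|\sum_(a <= i < b) w i * \1_P i|.
Proof.
pose p := [set i | 0 < w i]; pose q := [set i | w i < 0].
have E : \sum_(a <= i < b) `|w i| =
    \sum_(a <= i < b) w i * \1_p i - \sum_(a <= i < b) w i * \1_q i.
  rewrite -sumrB; apply: eq_bigr => i _; rewrite !indicE.
  have -> : (i \in p) = (0 < w i) by apply/idP/idP; rewrite inE.
  have -> : (i \in q) = (w i < 0) by apply/idP/idP; rewrite inE.
  case: (ltgtP (w i) 0) => [wi|wi|->]; last by rewrite normr0 !mul0r subr0.
    by rewrite ltr0_norm // mulr0 mulr1 sub0r.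
  by rewrite gtr0_norm // mulr0 mulr1 subr0.
have := ler_norm (\sum_(a <= i < b) w i * \1_p i).
have := ler_norm (- \sum_(a <= i < b) w i * \1_q i); rewrite normrN E.
have [h|/ltW h] := leP `|\sum_(a <= i < b) w i * \1_p i|
  `|\sum_(a <= i < b) w i * \1_q i|; [exists q | exists p]; lra.
Qed.

(* The Schur property of l^1, for finitely supported sequences. *)
Lemma cvg0_sum_norm (R : realType) (w : nat -> nat -> R) (M : nat -> nat) :
  (forall n i, (M n <= i)%N -> w n i = 0) ->
  (forall B : set nat,
     \sum_(0 <= i < M n) w n i * \1_B i @[n --> \oo] --> (0 : R)) ->
  \sum_(0 <= i < M n) `|w n i| @[n --> \oo] --> (0 : R).
Proof.
move=> w0 wB.
have sumE n m (g : nat -> R) : (M n <= m)%N ->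
    \sum_(0 <= i < m) w n i * g i = \sum_(0 <= i < M n) w n i * g i.
  move=> Mm; rewrite (big_cat_nat (n := M n)) //= [X in _ + X]big_nat_cond.
  rewrite [X in _ + X]big1 ?addr0 // => i /andP[/andP[Mi _] _].
  by rewrite w0 // mul0r.
(* Singletons as test sets give coordinatewise convergence. The range is enlarged to include [i],
   which may lie beyond [M n]. *)
have pt0 i : w n i @[n --> \oo] --> (0 : R).
  suff -> : w^~ i = fun n => \sum_(0 <= j < M n) w n j * \1_[set i] j.
    exact: wB.
  apply/funext => n; rewrite -(sumE _ (maxn i.+1 (M n))) ?leq_maxr //.
  rewrite big_mkord (bigD1 (Ordinal (leq_maxl i.+1 (M n)))) //= big1 ?addr0.
    by rewrite indicE mem_set // mulr1.
  move=> j /eqP ji; rewrite indicE memNset ?mulr0 // => /= ij.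
  by apply: ji; apply: val_inj.
have init0 m : \sum_(0 <= i < m) `|w n i| @[n --> \oo] --> (0 : R).
  elim: m => [|m IH].
    by under eq_fun do rewrite big_geq //; exact: cvg_cst.
  under eq_fun do rewrite big_nat_recr //=.
  have nrm : `|w n m| @[n --> \oo] --> `|0 : R| by exact: cvg_norm.
  rewrite normr0 in nrm.
  suff : \sum_(0 <= i < m) `|w n i| + `|w n m| @[n --> \oo] --> (0 + 0 : R).
    by rewrite addr0.
  exact: cvgD.
apply: contrapT => ncvg.
have [e e0 he] : exists2 e : R, 0 < e &
    forall N, exists2 n, (N <= n)%N & e <= \sum_(0 <= i < M n) `|w n i|.
  apply: contrapT => H; apply: ncvg; apply/cvgr0Pnorm_lt => e e0.
  apply: contrapT => H1; apply: H; exists e => // N.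
  apply: contrapT => H2; apply: H1; exists N => // n /= Nn.
  rewrite ger0_norm ?sumr_ge0 // ltNge; apply/negP => le.
  by apply: H2; exists n.
(* [step] gives a row [n] and a set [P] carrying a hump of [w n] beyond [m],
   with little mass before [m]; [B] collects the humps of a sequence of rows
   with successive supports. *)
have step m : exists nP : nat * set nat, [/\ (m <= nP.1)%N,
    \sum_(0 <= i < m) `|w nP.1 i| < e / 8 &
    e * (7 / 16) <= `|\sum_(m <= i < M nP.1 + m) w nP.1 i * \1_(nP.2) i|].
  have e8 : 0 < e / 8 by lra.
  have /cvgr0Pnorm_lt/(_ _ e8)[N _ hN] := init0 m.
  have [n Nn en] := he (maxn N m).
  (* At least [e - e / 8] of the row lies beyond [m] and [P] catches half of it, hence
     [e * (7 / 16)]. The upper end [M n + m] allows splitting at [m] even when [M n < m]. *)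
  have [P hP] := half_sum_norm_le (w n) m (M n + m).
  exists (n, P) => /=; have small : \sum_(0 <= i < m) `|w n i| < e / 8.
    have := hN n (leq_trans (leq_maxl _ _) Nn).
    by rewrite /= ger0_norm ?sumr_ge0.
  split => //; first exact: leq_trans (leq_maxr _ _) Nn.
  have : \sum_(0 <= i < M n) `|w n i| <=
      \sum_(0 <= i < m) `|w n i| + \sum_(m <= i < M n + m) `|w n i|.
    rewrite -big_cat_nat ?leq_addl //=.
    rewrite [X in _ <= X](big_cat_nat (n := M n)) ?leq_addr //=.
    by rewrite lerDl sumr_ge0.
  lra.
have [f hf] := choice step.
(* The next block starts past the hump of row [(f m).1] and past the support of that row, so later
   humps do not meet it. *)
pose next m := (M (f m).1 + m + (f m).1).+1.
pose m k := iter k next 0%N.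
have mlt k : (m k < m k.+1)%N by rewrite /= /next; lia.
have mle : {homo m : j k / (j <= k)%N}.
  apply: homo_leq => [//|x y z|k]; [exact: leq_trans | exact: ltnW].
pose B := [set i | exists k, (m k <= i < m k.+1)%N /\ (f (m k)).2 i].
have BP k i : (m k <= i < m k.+1)%N -> \1_B i = \1_((f (m k)).2) i :> R.
  move=> ki; rewrite !indicE; congr ((nat_of_bool _)%:R); apply/idP/idP.
    rewrite !inE => -[j [ji Pj]]; suff -> : k = j by [].
    apply/eqP; rewrite eqn_leq; apply/andP.
    move: ki ji => /andP[k1 k2] /andP[j1 j2]; split; rewrite leqNgt;
      apply/negP => /mle; lia.
  by rewrite !inE => Pi; exists k.
(* On the row chosen for block [N], the hump outweighs the mass before it by more than
   [7e/16 - e/8 = 5e/16]. This exceeds [e / 4], against convergence on [B]; the row is late enough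
   because its index is at least [m N >= N]. *)
have e4 : 0 < e / 4 by lra.
have /cvgr0Pnorm_lt/(_ _ e4)[N _ hN] := wB B.
have mN : (N <= m N)%N.
  by elim: (N) => // k IH; exact: leq_ltn_trans IH (mlt k).
have [mf small big] := hf (m N).
have := hN (f (m N)).1 (leq_trans mN mf).
set n := (f (m N)).1 in small big mf *.
have Mn : (M n <= M n + m N)%N by rewrite leq_addr.
rewrite /= -(sumE _ _ _ Mn) (big_cat_nat (n := m N)) ?leq_addl //=.
rewrite [X in _ + X]
  (eq_big_nat _ _ (F2 := fun i => w n i * \1_((f (m N)).2) i)); last first.
  move=> i /andP[i1 i2]; congr (_ * _); apply: BP; rewrite i1 /=.
  by apply: leq_trans i2 _; rewrite /next -/(m N) -/n; lia.
have : `|\sum_(0 <= i < m N) w n i * \1_B i| <= \sum_(0 <= i < m N) `|w n i|.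
  apply: le_trans (ler_norm_sum _ _ _) _; apply: ler_sum => i _.
  by rewrite normrM ler_piMr // indicE; case: (_ \in _); rewrite ?normr1 ?normr0.
set S := (X in `|X| <= _); set T := (X in _ <= `|X|) in big *.
have := lerB_normD T S; rewrite [T + S]addrC; lra.
Qed.

(** * Measures on N_F as finite coefficient sequences with a mass at p_F *)

Section FinitelySupportedMeasureTheory.
Variables (R : realType) (F : pfilter_on nat).
Implicit Types (mu : fs_measure R F) (A : set (filter_space F)).

Lemma fs_pt_bound mu : exists M, forall i, (M <= i)%N -> mu (pt F i) = 0.
Proof.
(* The shift by one puts the maximum strictly above every index in the support; p_F counts as 0. *)
pose c (x : filter_space F) := if x is Some i then i.+1 else 0%N.
exists (\max_(x <- finsupp mu) c x)%N => i Mi.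
apply/fsfun_dflt/negP => imu.
have : (c (pt F i) <= \max_(x <- finsupp mu) c x)%N by exact: leq_bigmax_seq.
by rewrite leqNgt => /negP; apply; rewrite ltnS.
Qed.

(** The points added to the support have coefficient 0, where [g] vanishes. This turns evaluations
    and norms into sums over an initial segment of omega plus one term at p_F. *)
Lemma big_finsupp mu M (g : filter_space F -> R) :
  (forall i, (M <= i)%N -> mu (pt F i) = 0) ->
  (forall x, mu x = 0 -> g x = 0) ->
  \sum_(x <- finsupp mu) g x = \sum_(0 <= i < M) g (pt F i) + g (pF F).
Proof.
move=> mu0 g0; pose r := rcons [seq pt F i | i <- index_iota 0 M] (pF F).
have ur : uniq r.
  rewrite rcons_uniq map_inj_uniq ?iota_uniq ?andbT; last by move=> i j [].
  by apply/mapP => -[].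
transitivity (\sum_(x <- r) g x).
  rewrite [RHS](bigID (fun x => x \in finsupp mu)) /=.
  rewrite [X in _ + X]big1 ?addr0; last by move=> x /fsfun_dflt/g0.
  rewrite -[RHS]big_filter; apply: perm_big; apply: uniq_perm => [||x].
  - exact: fset_uniq.
  - exact: filter_uniq.
  rewrite mem_filter; case xmu: (x \in finsupp mu) => //=.
  rewrite mem_rcons inE; case: x xmu => [i|] imu; last by rewrite eqxx.
  apply/esym/orP; right; apply/mapP; exists i => //.
  rewrite mem_index_iota /= ltnNge; apply/negP => /mu0 mui.
  by move: imu; rewrite mem_finsupp mui eqxx.
by rewrite /r -cats1 big_cat big_seq1 big_map.
Qed.

Lemma fs_evalE mu A M : (forall i, (M <= i)%N -> mu (pt F i) = 0) ->
  fs_eval mu A =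
    \sum_(0 <= i < M) mu (pt F i) * \1_A (pt F i) + mu (pF F) * \1_A (pF F).
Proof.
by move=> mu0; rewrite /fs_eval (big_finsupp mu0)// => x ->; rewrite mul0r.
Qed.

Lemma fs_normE mu M : (forall i, (M <= i)%N -> mu (pt F i) = 0) ->
  fs_norm mu = \sum_(0 <= i < M) `|mu (pt F i)| + `|mu (pF F)|.
Proof.
by move=> mu0; rewrite /fs_norm (big_finsupp mu0)// => x ->; rewrite normr0.
Qed.

(** The listed points only bound the support: those with coefficient 0 drop out of [finsupp]. *)
Definition fs_of (c : nat -> R) (M : nat) (d : R) : fs_measure R F :=
  [fsfun x in pF F |` [fset pt F i | i in iota 0 M]
     => if x is Some i then c i else d]%fset.

Lemma fs_of_pF c M d : fs_of c M d (pF F) = d.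
Proof. by rewrite fsfunE in_fset1U eqxx. Qed.

Lemma fs_of_pt c M d i : fs_of c M d (pt F i) = if (i < M)%N then c i else 0.
Proof.
rewrite fsfunE in_fset1U /=.
suff -> : (pt F i \in [fset pt F i | i in iota 0 M])%fset = (i < M)%N by [].
apply/imfsetP/idP => [[j /=]|iM]; first by rewrite mem_iota => jM [->].
by exists i; rewrite //= mem_iota.
Qed.

Lemma fs_of_ge c M d i : (M <= i)%N -> fs_of c M d (pt F i) = 0.
Proof. by rewrite fs_of_pt leqNgt => /negbTE ->. Qed.

Lemma mem_pt_image (B : set nat) i : (pt F i \in pt F @` B) = (i \in B).
Proof.
apply/idP/idP; rewrite !inE; last by move=> Bi; exists i.
by case=> j Bj [<-].
Qed.

Lemma mem_omegaD_pt (B : set nat) i :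
  (pt F i \in omega F `\` pt F @` B) = (i \in ~` B).
Proof.
apply/idP/idP; rewrite !inE; first by case=> _ nBi Bi; apply: nBi; exists i.
by move=> nBi; split; [exists i | move=> [j Bj [ji]]; apply: nBi; rewrite -ji].
Qed.

(** The image misses p_F, so it is open, and its complement has trace in [F]. This makes every
    subset of the complement of a set in [F] available as a test set for the Schur property. *)
Lemma clopen_pt_image (B : set nat) : F (~` B) -> clopen (pt F @` B).
Proof.
move=> FB; split; first by apply/open_fsE => -[].
rewrite -openC; apply/open_fsE => _; apply: filterS FB => i nBi [j Bj [ji]].
by apply: nBi; rewrite -ji.
Qed.

Lemma clopen_trace A : clopen A -> A (pF F) -> F (pt F @^-1` A).
Proof. by case=> /open_fsE. Qed.

Lemma clopen_traceC A : clopen A -> ~ A (pF F) -> F (~` (pt F @^-1` A)).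
Proof. by case=> _; rewrite -openC => /open_fsE. Qed.

Lemma fs_of_nonneg c M d :
  (forall i, 0 <= c i) -> 0 <= d -> fs_nonneg (fs_of c M d).
Proof.
move=> c0 d0 A; apply: sumr_ge0 => x _; apply: mulr_ge0; last first.
  by rewrite indicE; case: (_ \in _).
case: x => [i|]; last by rewrite [X in 0 <= X](_ : _ = d) ?fs_of_pF.
by rewrite [X in 0 <= X]fs_of_pt; case: ifP.
Qed.

(** * Passing between anti-Nikodym sequences and those of (b) and (c) *)

(* Subtracting the total mass of [mu n] at p_F, the measure of a clopen set
   becomes, up to sign, the value of [mu n] on the complement of a set in F. *)
Lemma dual_vanishing_anti_Nikodym (mu : nat -> fs_measure R F) :
  dual_vanishing mu -> exists nu : nat -> fs_measure R F, anti_Nikodym nu.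
Proof.
move=> [_ sub tot van]; have [M hM] := choice (fun n => fs_pt_bound (mu n)).
have mup n : mu n (pF F) = 0.
  apply/fsfun_dflt/negP => h; have : supp (mu n) (pF F) by [].
  by move=> /sub[].
pose s n := \sum_(0 <= i < M n) mu n (pt F i).
pose nu n := fs_of (fun i => mu n (pt F i)) (M n) (- s n).
have nuM n i : (M n <= i)%N -> nu n (pt F i) = 0 by exact: fs_of_ge.
have nuE n i : nu n (pt F i) = mu n (pt F i).
  by rewrite fs_of_pt; case: ltnP => // /hM ->.
have totE n : fs_eval (mu n) (omega F) = s n.
  rewrite (fs_evalE _ (hM n)) mup mul0r addr0; apply: eq_bigr => i _.
  by rewrite indicE mem_set ?mulr1 //; exists i.
have vanE n B : fs_eval (mu n) (omega F `\` (pt F @` B)) =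
    \sum_(0 <= i < M n) mu n (pt F i) * \1_(~` B) i.
  rewrite (fs_evalE _ (hM n)) mup mul0r addr0; apply: eq_bigr => i _.
  by rewrite !indicE mem_omegaD_pt.
have evalE n A : fs_eval (nu n) A =
    \sum_(0 <= i < M n) mu n (pt F i) * \1_(pt F @^-1` A) i - s n * \1_A (pF F).
  rewrite (fs_evalE _ (nuM n)) fs_of_pF mulNr; congr (_ - _).
  by apply: eq_bigr => i _; rewrite nuE !indicE.
exists nu; split.
  apply/cvgryPge => K; move/cvgryPge: tot => /(_ K); apply: filterS => n.
  rewrite totE (fs_normE (nuM n)) fs_of_pF => /le_trans; apply.
  apply: ler_wpDr => //; apply: ler_sum => i _; rewrite nuE; exact: ler_norm.
move=> A cA; have [Ap|nAp] := pselect (A (pF F)).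
  suff -> : (fun n => fs_eval (nu n) A) =
      - (fun n => fs_eval (mu n) (omega F `\` (pt F @` (pt F @^-1` A)))).
    by rewrite -oppr0; apply: cvgN; apply/van/clopen_trace.
  apply/funext => n.
  transitivity (- fs_eval (mu n) (omega F `\` (pt F @` (pt F @^-1` A)))) => //.
  rewrite evalE vanE /s [X in _ * X]indicE mem_set // mulr1.
  rewrite -sumrB -sumrN; apply: eq_bigr => i _.
  rewrite !indicE in_setC; case: (_ \in _) => /=;
    by rewrite ?mulr1 ?mulr0 ?subrr ?oppr0 ?sub0r.
suff -> : (fun n => fs_eval (nu n) A) =
    (fun n => fs_eval (mu n) (omega F `\` (pt F @` (~` (pt F @^-1` A))))).
  by apply/van/clopen_traceC.
apply/funext => n; rewrite evalE vanE setCK.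
by rewrite [X in _ - _ * X]indicE memNset //= mulr0 subr0.
Qed.

(** Disjointness of supports comes with the construction, so an anti-Nikodym sequence refutes (b)
    and (c) at once. *)
Lemma anti_Nikodym_dual_vanishing (mu : nat -> fs_measure R F) :
  free_filter F -> anti_Nikodym mu ->
  exists nu : nat -> fs_measure R F,
    dual_vanishing nu /\ trivIset setT (fun n => supp (nu n)).
Proof.
move=> freeF [muN mu0]; have [M hM] := choice (fun n => fs_pt_bound (mu n)).
pose a n i := mu n (pt F i).
have small G : F G ->
    \sum_(0 <= i < M n) `|a n i * \1_(~` G) i| @[n --> \oo] --> (0 : R).
  move=> FG; apply: cvg0_sum_norm => [n i /hM ani|B].
    by rewrite /a ani mul0r.
  have cB : clopen (pt F @` (B `&` ~` G)).
    by apply: clopen_pt_image; apply: filterS FG => i Gi [].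
  suff -> : (fun n => \sum_(0 <= i < M n) a n i * \1_(~` G) i * \1_B i) =
      (fun n => fs_eval (mu n) (pt F @` (B `&` ~` G))) by exact: mu0.
  apply/funext => n; rewrite (fs_evalE _ (hM n)) [X in _ = _ + _ * X]indicE.
  rewrite memNset ?mulr0 ?addr0; last by case.
  apply: eq_bigr => i _; rewrite -mulrA; congr (_ * _).
  by rewrite !indicE mem_pt_image in_setI andbC -natrM mulnb.
have large : \sum_(0 <= i < M n) `|a n i| @[n --> \oo] --> +oo.
  apply/cvgryPge => K; have cT : clopen [set: filter_space F] by exact: clopenT.
  (* Once the total value is below 1 in modulus, the mass at p_F is at most 1 plus the sum of the
     [|a n i|], and the norm at most 1 plus twice that sum; hence the threshold [2 * K + 1]. *)
  have /cvgr0Pnorm_lt/(_ _ ltr01) := mu0 _ cT.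
  move/cvgryPge: muN => /(_ (2 * K + 1)); apply: filterS2 => n.
  have -> : fs_eval (mu n) setT = \sum_(0 <= i < M n) a n i + mu n (pF F).
    rewrite (fs_evalE _ (hM n)) indicT mulr1; congr (_ + _).
    by apply: eq_bigr => i _; rewrite mulr1.
  rewrite (fs_normE (hM n)).
  have := ler_norm_sum (index_iota 0 (M n)) (a n) xpredT.
  have := ler_normB (\sum_(0 <= i < M n) a n i + mu n (pF F))
                    (\sum_(0 <= i < M n) a n i).
  by rewrite addrAC subrr add0r /a; lra.
pose tail m n i : R := if (m <= i)%N then `|a n i| else 0.
have tail_ge0 m n i : 0 <= tail m n i by rewrite /tail; case: ifP.
(* As [F] is free, the mass below [mk.1] is eventually less than 1, while the total eventually
   reaches [mk.2 + 1]. The demand [mk.2 <= n] makes the chosen rows tend to infinity. *)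
have step (mk : nat * nat) : exists n, (mk.2 <= n)%N /\
    mk.2%:R <= \sum_(0 <= i < M n) tail mk.1 n i.
  case: mk => m k /=; have FI : F (~` `I_m).
    by apply: freeF; rewrite setCK; exact: finite_II.
  have /cvgr0Pnorm_lt/(_ _ ltr01)[N1 _ h1] := small _ FI.
  move/cvgryPge: large => /(_ (k%:R + 1))[N2 _ h2].
  exists (maxn k (maxn N1 N2)); split; first exact: leq_maxl.
  set n := maxn _ _.
  have /h1 : (N1 <= n)%N by rewrite /n; lia.
  have /h2 : (N2 <= n)%N by rewrite /n; lia.
  rewrite /= ger0_norm ?sumr_ge0 // setCK => l1 l2.
  suff : \sum_(0 <= i < M n) `|a n i| <=
    \sum_(0 <= i < M n) `|a n i * \1_(`I_m) i| + \sum_(0 <= i < M n) tail m n i.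
    lra.
  rewrite -big_split; apply: ler_sum => i _ /=; rewrite /tail indicE.
  case: leqP => im; first by rewrite lerDr.
  by rewrite mem_set // mulr1 addr0.
have [f hf] := choice step.
(* [m k] bounds the supports on omega of all rows chosen before stage [k], so cutting the new row
   below [m k] separates it from them. *)
pose m := fix m k := if k is k'.+1 then maxn (m k') (M (f (m k', k'))) else 0%N.
pose n k := f (m k, k).
have mS k : m k.+1 = maxn (m k) (M (n k)) by [].
have mle : {homo m : j k / (j <= k)%N}.
  by apply: homo_leq => [//|x y z|k]; [exact: leq_trans | rewrite mS leq_maxl].
pose nu k := fs_of (tail (m k) (n k)) (M (n k)) 0.
have nuM k i : (M (n k) <= i)%N -> nu k (pt F i) = 0 by exact: fs_of_ge.
have nuE k i : nu k (pt F i) = tail (m k) (n k) i.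
  by rewrite fs_of_pt; case: ltnP => // /hM h; rewrite /tail /a h normr0 if_same.
have nup k : nu k (pF F) = 0 by exact: fs_of_pF.
have supp_nu k x : supp (nu k) x -> exists2 i, x = pt F i & (m k <= i < m k.+1)%N.
  rewrite /supp [X in X -> _]/= mem_finsupp.
  case: x => [i|]; last by rewrite nup eqxx.
  move=> nui; exists i => //; apply/andP; split.
    rewrite leqNgt; apply/negP => im; move: nui.
    by rewrite nuE /tail leqNgt im eqxx.
  rewrite mS leq_max ltnNge [in X in _ || X]ltnNge; apply/orP; right.
  by apply/negP => /nuM h; rewrite h eqxx in nui.
exists nu; split; [split => [k|k x /supp_nu[i -> _]||A FA]|].
- by apply: fs_of_nonneg.
- by exists i.
- apply/cvgryPge => K; have := nbhs_infty_ger K; apply: filterS => k Kk.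
  rewrite (fs_evalE _ (nuM k)) nup mul0r addr0; apply: le_trans Kk _.
  have [_ /le_trans] := hf (m k, k); apply; apply: ler_sum => i _.
  by rewrite nuE indicE mem_set ?mulr1 //; exists i.
- apply/cvgr0Pnorm_lt => e e0.
  (* [nu k] is dominated on omega by the modulus of row [n k], and [n k >= k], so [small] carries
     over. *)
  have /cvgr0Pnorm_lt/(_ _ e0)[N _ hN] := small _ FA.
  exists N => // k /= Nk; have [kn _] := hf (m k, k).
  apply: le_lt_trans (hN (n k) (leq_trans Nk kn)) => /=.
  rewrite [X in X <= _]ger0_norm; last exact: fs_of_nonneg.
  rewrite [X in _ <= X]ger0_norm ?sumr_ge0 //.
  rewrite (fs_evalE _ (nuM k)) nup mul0r addr0; apply: ler_sum => i _.
  rewrite nuE !indicE mem_omegaD_pt normrM [X in _ <= _ * X]ger0_norm //.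
  by rewrite ler_wpM2r // /tail; case: ifP.
move=> j k _ _ [x [/supp_nu[i -> ij] /supp_nu[i' [<-] ik]]].
apply/eqP; rewrite eqn_leq; move: ij ik => /andP[j1 j2] /andP[k1 k2].
by apply/andP; split; rewrite leqNgt; apply/negP => /mle; lia.
Qed.

End FinitelySupportedMeasureTheory.

Theorem mainTheorem1 (R : realType) (F : pfilter_on nat) (hF : free_filter F) :
  (Nikodym R F <->
     ~ exists mu : nat -> fs_measure R F, dual_vanishing mu) /\
  (Nikodym R F <->
     ~ exists mu : nat -> fs_measure R F,
         dual_vanishing mu /\ trivIset setT (fun n => supp (mu n))).
Proof.
split; split => [nik|ndual].
- by case=> mu /dual_vanishing_anti_Nikodym.
- case=> mu /(anti_Nikodym_dual_vanishing hF)[nu [dnu _]].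
  by apply: ndual; exists nu.
- by case=> mu [/dual_vanishing_anti_Nikodym].
- by case=> mu /(anti_Nikodym_dual_vanishing hF).
Qed.
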